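(* Let $f=\frac1n\sum_{i=1}^n f_i$ where each $f_i:\mathbb{R}^d\to\mathbb{R}$ is $L_i$-smooth (not necessarily convex), $f$ is $L$-smooth, and $f$ satisfies the Polyak-Lojasiewicz condition with constant $\mu>0$: $$\|\nabla f(x)\|^2\ge2\mu(f(x)-f^* )\quad\text{for all }x\in\mathbb{R}^d.$$ Let $x^*$ be a minimizer of $f$ and $L_{\max}=\max_{1\le i\le n}L_i$. Then the iterates of SGD with constant step-size $\gamma_k=\gamma$, $0<\gamma\le\frac{\mu}{L_{\max}^2}$, satisfy, for all $k\ge0$, $$\mathbb{E}[f(x^k)-f(x^* )]\le\nu^k\,[f(x^0)-f(x^* )]+\frac{L\sigma^2\gamma}{2(1-\nu)c},\qquad\text{where } \nu=1-\mu\gamma,\quad c=\frac{L_{\max}}{2\mu}.$$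
   Context: Setting: $f(x)=\frac1n\sum_{i=1}^n f_i(x)$ is minimized over $\mathbb{R}^d$; the set $\mathcal{X}^*$ of minimizers of $f$ is nonempty and $f^*=f(x^* )$ is the minimum value. A function is $L$-smooth if it is differentiable with $L$-Lipschitz gradient. $L$ and $L_i$ denote the smoothness constants of $f$ and $f_i$, with $L\le L_{\max}$. For each $i$, $f_i^*:=\inf_x f_i(x)$, and it is assumed throughout that $\sigma^2:=\mathbb{E}_i[f_i(x^* )-f_i^*]=f(x^* )-\frac1n\sum_{i=1}^n f_i^*<\infty$ (so all $f_i^*$ are finite), where $x^*\in\mathcal{X}^*$. SGD with constant step-size $\gamma$: starting from a deterministic $x^0$, at each iteration $k$ an index $i\in\{1,\dots,n\}$ is drawn uniformly at random, independently of the past, and $x^{k+1}=x^k-\gamma\nabla f_i(x^k)$. *)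

(* Defs.v *)
From HB Require Import structures.
From mathcomp Require Import all_boot all_order all_algebra finmap.
From mathcomp Require Import all_classical all_reals all_analysis.
Set Implicit Arguments.
Unset Strict Implicit.
Unset Printing Implicit Defensive.
Import Order.TTheory GRing.Theory Num.Theory.
Import numFieldNormedType.Exports.
Local Open Scope classical_set_scope.
Local Open Scope ring_scope.

(* The norm that MathComp-Analysis puts on ['rV[R]_d] is the sup norm, hence
   this separate Euclidean norm.  The two are equivalent, so [differentiable]
   has its usual meaning. *)
Definition enorm (R : realType) (d : nat) (v : 'rV[R]_d) : R :=
  Num.sqrt (\sum_(j < d) v 0 j ^+ 2).

Definition gradient (R : realType) (d : nat) (f : 'rV[R]_d -> R)
    (x : 'rV[R]_d) : 'rV[R]_d :=
  \row_(j < d) 'D_(delta_mx 0 j) f x.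

(* [0 <= L] follows from the Lipschitz bound unless [d = 0]. *)
Definition smooth (R : realType) (d : nat) (L : R) (f : 'rV[R]_d -> R) : Prop :=
  [/\ 0 <= L,
      forall x, differentiable f x &
      forall x y, enorm (gradient f x - gradient f y) <= L * enorm (x - y)].

Definition minimizer (R : realType) (d : nat) (f : 'rV[R]_d -> R)
    (xs : 'rV[R]_d) : Prop :=
  forall x, f xs <= f x.

Definition polyak_lojasiewicz (R : realType) (d : nat) (mu fstar : R)
    (f : 'rV[R]_d -> R) : Prop :=
  forall x, enorm (gradient f x) ^+ 2 >= 2 * mu * (f x - fstar).

Definition average (R : realType) (d n : nat) (f_ : 'I_n -> 'rV[R]_d -> R)
    (x : 'rV[R]_d) : R :=
  n%:R^-1 * \sum_(i < n) f_ i x.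

Definition infimum (R : realType) (d : nat) (f : 'rV[R]_d -> R) : \bar R :=
  ereal_inf (range (fun x => (f x)%:E)).

(* Extended-real valued: equal to [+oo] when some [f_ i] is unbounded below. *)
Definition gradient_noise (R : realType) (d n : nat)
    (f_ : 'I_n -> 'rV[R]_d -> R) (xs : 'rV[R]_d) : \bar R :=
  ((n%:R^-1)%:E * \sum_(i < n) ((f_ i xs)%:E - infimum (f_ i)))%E.

Fixpoint sgd (R : realType) (d n : nat) (f_ : 'I_n -> 'rV[R]_d -> R)
    (gamma : R) (x0 : 'rV[R]_d) (idx : nat -> 'I_n) (k : nat) : 'rV[R]_d :=
  if k is k'.+1 then
    let x := sgd f_ gamma x0 idx k' in
    x - gamma *: gradient (f_ (idx k')) x
  else x0.

(* ['I_n] carries the discrete sigma-algebra: every set [A] is an event. *)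
Definition random_index d (T : measurableType d) (n : nat) (X : T -> 'I_n) :
    Prop :=
  forall A : set 'I_n, measurable (X @^-1` A).

Definition uniform_index d (T : measurableType d) (R : realType)
    (P : probability T R) (n : nat) (X : T -> 'I_n) : Prop :=
  forall i : 'I_n, P (X @^-1` [set i]) = (n%:R^-1)%:E.

Definition mutually_independent d (T : measurableType d) (R : realType)
    (P : probability T R) (n : nat) (X : nat -> T -> 'I_n) : Prop :=
  forall (s : {fset nat}) (A : nat -> set 'I_n),
    P (\bigcap_(k in [set` s]) (X k @^-1` A k)) =
    (\prod_(k <- s) P (X k @^-1` A k))%E.

(* Main.v *)
Require Import Defs.
From HB Require Import structures.
From mathcomp Require Import all_boot all_order all_algebra finmap.
From mathcomp Require Import all_classical all_reals all_analysis.
From mathcomp Require Import ring lra.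
Set Implicit Arguments.
Unset Strict Implicit.
Unset Printing Implicit Defensive.
Import Order.TTheory GRing.Theory Num.Theory.
Import numFieldNormedType.Exports.
Local Open Scope classical_set_scope.
Local Open Scope ring_scope.

(** Write [delta x = f x - f xs], [M = Lmax], and [s = sigma2]. Conditionally on
    the current iterate [x], the expected next value of [delta] is its average
    over the [n] possible steps. The descent inequality for [f], the inequality
    [|grad f_i x|^2 <= 2 M (f_i x - inf f_i)] and
    [f_i x - inf f_i = (f_i x - f_i xs) + (f_i xs - inf f_i)] bound this average
    by
      [delta x - gamma |grad f x|^2 + L gamma^2 M (delta x + s)].
    By the Polyak-Lojasiewicz inequality the gradient term contributes at most
    [- 2 mu gamma delta x]; since [L <= M] and [gamma M^2 <= mu], the curvature
    term gives back at most [mu gamma delta x], and the noise term is at most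
    [mu gamma (L s / M)]. Hence one step maps [delta] below
    [nu delta + (1 - nu) B] with [nu = 1 - mu gamma] and [B = L s / M]
    ([sgd_one_step]), and [B] is exactly the residual in the theorem.

    Iterating the averaging operator gives [nu^k delta + (1 - nu^k) B]
    ([iter_markov_contract]). This requires [0 <= nu], that is
    [mu gamma <= 1], which follows from [mu <= M]; the alternative is that [f]
    is constant, and then the claim is trivial
    ([pl_constant_le_smoothness]).

    The probabilistic content is that the expectation along the trajectory is
    the iterated average, i.e. that the iterate at time [k] is independent of
    the index drawn at time [k] ([integral_chain_cylinder]). *)

(** * The Euclidean inner product *)

Definition dot (R : realType) (d : nat) (u v : 'rV[R]_d) : R :=
  \sum_(j < d) u 0 j * v 0 j.

Lemma dotDl (R : realType) (d : nat) (u v w : 'rV[R]_d) :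
  dot (u + v) w = dot u w + dot v w.
Proof. by rewrite -big_split; apply: eq_bigr => j _ /=; rewrite mxE mulrDl. Qed.

Lemma dotZl (R : realType) (d : nat) (a : R) (u v : 'rV[R]_d) :
  dot (a *: u) v = a * dot u v.
Proof. by rewrite mulr_sumr; apply: eq_bigr => j _; rewrite mxE mulrA. Qed.

Lemma dotC (R : realType) (d : nat) (u v : 'rV[R]_d) : dot u v = dot v u.
Proof. by apply: eq_bigr => j _; rewrite mulrC. Qed.

Lemma dotvv_ge0 (R : realType) (d : nat) (u : 'rV[R]_d) : 0 <= dot u u.
Proof. by apply: sumr_ge0 => j _; rewrite -expr2 sqr_ge0. Qed.

Lemma enorm_ge0 (R : realType) (d : nat) (u : 'rV[R]_d) : 0 <= enorm u.
Proof. exact: sqrtr_ge0. Qed.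

Lemma enorm_sqr (R : realType) (d : nat) (u : 'rV[R]_d) :
  enorm u ^+ 2 = dot u u.
Proof.
rewrite sqr_sqrtr; first by apply: eq_bigr => j _; rewrite expr2.
by apply: sumr_ge0 => j _; rewrite sqr_ge0.
Qed.

Lemma enormZ (R : realType) (d : nat) (a : R) (u : 'rV[R]_d) :
  enorm (a *: u) = `|a| * enorm u.
Proof.
apply/eqP; rewrite -(eqrXn2 (n := 2)) ?mulr_ge0 ?enorm_ge0 //.
by rewrite exprMn !enorm_sqr dotZl dotC dotZl real_normK ?num_real // mulrA.
Qed.

(** Cauchy-Schwarz: when both norms are nonzero, expand
    [0 <= | |v| u - |u| v |^2]. *)
Lemma dot_le_enorm (R : realType) (d : nat) (u v : 'rV[R]_d) :
  dot u v <= enorm u * enorm v.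
Proof.
have vanish (w z : 'rV[R]_d) : enorm w = 0 -> dot w z = 0.
  move=> w0; have: dot w w = 0 by rewrite -enorm_sqr w0 expr0n.
  move=> /psumr_eq0P w2; apply: big1 => j _.
  have /eqP := w2 (fun i _ => sqr_ge0 (w 0 i)) j isT.
  by rewrite mulf_eq0 orbb => /eqP ->; rewrite mul0r.
have [u0|u_neq0] := eqVneq (enorm u) 0; first by rewrite vanish // u0 mul0r.
have [v0|v_neq0] := eqVneq (enorm v) 0.
  by rewrite dotC vanish // v0 mulr0.
have u_gt0 : 0 < enorm u by rewrite lt_def u_neq0 enorm_ge0.
have v_gt0 : 0 < enorm v by rewrite lt_def v_neq0 enorm_ge0.
have := dotvv_ge0 (enorm v *: u + (- enorm u) *: v).
rewrite dotDl !dotZl !(dotC _ (_ + _)) !dotDl !dotZl -!enorm_sqr (dotC v u).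
have -> : enorm v * (enorm v * enorm u ^+ 2 + - enorm u * dot u v) +
    - enorm u * (enorm v * dot u v + - enorm u * enorm v ^+ 2) =
    2 * (enorm u * enorm v) * (enorm u * enorm v - dot u v) by ring.
by rewrite pmulr_rge0 ?subr_ge0 // !mulr_gt0.
Qed.

(** * Descent along a smooth function *)

Lemma deriv_gradient (R : realType) (d : nat) (f : 'rV[R]_d -> R)
    (x v : 'rV[R]_d) :
  differentiable f x -> 'D_v f x = dot (gradient f x) v.
Proof.
move=> fx; rewrite deriveE // [in LHS](row_sum_delta v) linear_sum.
by apply: eq_bigr => j _; rewrite linearZ /= mxE deriveE // mulrC.
Qed.

Lemma is_derive_line (R : realType) (d : nat) (f : 'rV[R]_d -> R)
    (x v : 'rV[R]_d) (t : R) :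
  differentiable f (x + t *: v) ->
  is_derive t 1 (fun s : R => f (x + s *: v)) (dot (gradient f (x + t *: v)) v).
Proof.
move=> fx; have fD := @diff_derivable _ _ _ f _ v fx.
have quotientE : (fun h : R => h^-1 *: (f (x + (h *: 1 + t) *: v)
      - f (x + t *: v))) =
    (fun h : R => h^-1 *: (f (h *: v + (x + t *: v)) - f (x + t *: v))).
  apply/funext => h; congr (_ *: (f _ - _)).
  by rewrite scalerDl /GRing.scale /= mulr1 addrCA.
apply: DeriveDef; first by rewrite /derivable /= quotientE.
by rewrite -deriv_gradient // /derive /= quotientE.
Qed.

(** Along the segment from [x] to [x + v], the derivative of [f] exceeds its
    value at [x] by at most [L t |v|^2], by Cauchy-Schwarz and the Lipschitz
    bound. So [f] minus the quadratic [q] is nonincreasing for [t] between [0]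
    and [1]. *)
Lemma descent_lemma (R : realType) (d : nat) (L : R) (f : 'rV[R]_d -> R)
    (x v : 'rV[R]_d) :
  smooth L f ->
  f (x + v) <= f x + dot (gradient f x) v + L / 2 * enorm v ^+ 2.
Proof.
move=> [L_ge0 fD fL].
pose q (t : R) : R := dot (gradient f x) v * t + L / 2 * enorm v ^+ 2 * t ^+ 2.
pose phi (t : R) : R := f (x + t *: v) - q t.
pose dphi (t : R) : R :=
  dot (gradient f (x + t *: v)) v
  - (dot (gradient f x) v + L * enorm v ^+ 2 * t).
have phiD (t : R) : is_derive t 1 phi (dphi t).
  have lineD := is_derive_line (fD (x + t *: v)).
  apply: is_deriveB.
  rewrite /q; apply: is_derive_eq.
  rewrite /GRing.scale /=.
  by field.
have phiE (t : R) : derive1 phi t = dphi t by rewrite derive1E derive_val.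
have: phi 1 <= phi 0.
  apply: (@ler0_derive1_nincr _ _ 0 1) => // [t|].
  - rewrite phiE in_itv /= => /andP[t_gt0 _].
    rewrite subr_le0 -lerBlDl -mulN1r -dotZl -dotDl scaleN1r.
    apply: le_trans (dot_le_enorm _ _) _.
    have := fL (x + t *: v) x.
    rewrite [x + _]addrC addrK enormZ gtr0_norm //.
    move=> /(ler_wpM2r (enorm_ge0 v)).
    by rewrite (_ : _ * _ * _ = L * enorm v ^+ 2 * t) //; ring.
  - apply: continuous_subspaceT => t.
    exact/differentiable_continuous/derivable1_diffP.
rewrite /phi /q scale1r scale0r addr0 !mulr1 mulr0 expr1n expr0n /=; lra.
Qed.

Lemma smooth_weaken (R : realType) (d : nat) (L M : R) (f : 'rV[R]_d -> R) :
  L <= M -> smooth L f -> smooth M f.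
Proof.
move=> LM [L_ge0 fD fL]; split=> // [|x y]; first exact: le_trans LM.
by apply: le_trans (fL x y) _; rewrite ler_wpM2r ?enorm_ge0.
Qed.

(** A gradient step of length [1 / L] decreases [f] by at least
    [|grad f x|^2 / (2 L)], and it cannot go below the lower bound [m]. *)
Lemma gradient_sqr_le (R : realType) (d : nat) (L m : R) (f : 'rV[R]_d -> R)
    (x : 'rV[R]_d) :
  0 < L -> smooth L f -> (forall y, m <= f y) ->
  enorm (gradient f x) ^+ 2 <= 2 * L * (f x - m).
Proof.
move=> L_gt0 fL fm.
have := le_trans (fm _) (descent_lemma x (- L^-1 *: gradient f x) fL).
rewrite dotC dotZl -enorm_sqr enormZ normrN gtr0_norm ?invr_gt0 //.
set G := enorm _ => mle; have L_neq0 : L != 0 by rewrite gt_eqF.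
have -> : G ^+ 2 = 2 * L * (f x - (f x - (2 * L)^-1 * G ^+ 2)) by field.
rewrite ler_pM2l ?mulr_gt0 // lerB // (le_trans mle) // le_eqVlt.
by apply/orP; left; apply/eqP; field.
Qed.

(** * One step of the method, in conditional expectation *)

Definition mean (R : realType) (n : nat) (F : 'I_n -> R) : R :=
  n%:R^-1 * \sum_(i < n) F i.

Lemma le_mean (R : realType) (n : nat) (F G : 'I_n -> R) :
  (forall i, F i <= G i) -> mean F <= mean G.
Proof.
by move=> FG; rewrite ler_wpM2l ?invr_ge0 ?ler0n // ler_sum.
Qed.

Lemma meanD (R : realType) (n : nat) (F G : 'I_n -> R) :
  mean (fun i => F i + G i) = mean F + mean G.
Proof. by rewrite /mean big_split mulrDr. Qed.

Lemma meanZ (R : realType) (n : nat) (a : R) (F : 'I_n -> R) :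
  mean (fun i => a * F i) = a * mean F.
Proof. by rewrite /mean -mulr_sumr mulrCA. Qed.

Lemma mean_cst (R : realType) (n : nat) (a : R) :
  (0 < n)%N -> mean (fun _ : 'I_n => a) = a.
Proof.
move=> n_gt0; rewrite /mean sumr_const card_ord -[a *+ n]mulr_natl mulKf //.
by rewrite pnatr_eq0 -lt0n.
Qed.

Lemma mean_dot (R : realType) (d n : nat) (g : 'I_n -> 'rV[R]_d)
    (u : 'rV[R]_d) :
  mean (fun i => dot (g i) u) = dot (n%:R^-1 *: \sum_(i < n) g i) u.
Proof.
rewrite dotZl; congr (_ * _); rewrite exchange_big; apply: eq_bigr => j _ /=.
by rewrite summxE mulr_suml.
Qed.

Lemma gradient_average (R : realType) (d n : nat)
    (f_ : 'I_n -> 'rV[R]_d -> R) (x : 'rV[R]_d) :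
  (forall i, differentiable (f_ i) x) ->
  gradient (average f_) x = n%:R^-1 *: \sum_(i < n) gradient (f_ i) x.
Proof.
move=> fD; apply/rowP => j; rewrite !mxE summxE.
have -> : average f_ = n%:R^-1 \*: (\sum_(i < n) f_ i).
  by apply/funext => y; rewrite /average /= fct_sumE.
have fDj i : derivable (f_ i) x (delta_mx 0 j) by exact: diff_derivable.
rewrite deriveZ; last exact: derivable_sum.
by rewrite derive_sum //; congr (_ * _); apply: eq_bigr => i _; rewrite mxE.
Qed.

(** Every term of the noise is above [-oo], so one function unbounded below
    would make the whole sum [+oo]. The lower bounds [m i] are the infima;
    having them as reals keeps the rest of the argument out of the extended
    reals. *)
Lemma gradient_noise_finite (R : realType) (d n : nat)
    (f_ : 'I_n -> 'rV[R]_d -> R) (xs : 'rV[R]_d) :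
  (0 < n)%N -> (gradient_noise f_ xs < +oo)%E ->
  exists m : 'I_n -> R, (forall i x, m i <= f_ i x) /\
    fine (gradient_noise f_ xs) = mean (fun i => f_ i xs - m i).
Proof.
move=> n_gt0 noise_lty.
have inf_le i x : (Defs.infimum (f_ i) <= (f_ i x)%:E)%E.
  by apply: ereal_inf_lbound; exists x.
have inf_lty i : (Defs.infimum (f_ i) < +oo)%E.
  by apply: le_lt_trans (inf_le i xs) _; rewrite ltry.
have inf_fin i : Defs.infimum (f_ i) \is a fin_num.
  rewrite fin_numE (lt_eqF (inf_lty i)) andbT; apply/negP => /eqP infNy.
  move: noise_lty; rewrite /gradient_noise ltey => /negP; apply.
  rewrite mule_eq_pinfty lte_fin invr_gt0 ltr0n n_gt0 /=.
  apply/orP; left; apply/eqP/esum_eqyP.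
    by move=> j _; case: (Defs.infimum (f_ j)) (inf_lty j).
  by exists i; rewrite mem_index_enum infNy.
exists (fun i => fine (Defs.infimum (f_ i))); split=> [i x|].
  by rewrite -lee_fin fineK.
rewrite /gradient_noise /mean.
under eq_bigr => i _ do rewrite -(fineK (inf_fin i)) -EFinB.
by rewrite sumEFin -EFinM.
Qed.

(** The contraction in expectation. The step-size condition is used twice, as
    [gamma M^2 <= mu]: together with [L <= M] it leaves at least half of the
    decrease granted by the Polyak-Lojasiewicz inequality, and it bounds the
    noise term [L gamma^2 M s] by [mu gamma (L s / M)]. *)
Lemma sgd_one_step (R : realType) (d n : nat) (f_ : 'I_n -> 'rV[R]_d -> R)
    (m : 'I_n -> R) (L M mu gamma : R) (xs x : 'rV[R]_d) :
  let f := average f_ in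
  let s := mean (fun i => f_ i xs - m i) in
  (0 < n)%N -> 0 < M -> (forall i, smooth M (f_ i)) -> smooth L f -> L <= M ->
  (forall i y, m i <= f_ i y) -> minimizer f xs ->
  polyak_lojasiewicz mu (f xs) f ->
  0 < gamma -> gamma <= mu / M ^+ 2 ->
  mean (fun i => f (x - gamma *: gradient (f_ i) x) - f xs)
    <= (1 - mu * gamma) * (f x - f xs) + mu * gamma * (L * s / M).
Proof.
move=> f s n_gt0 M_gt0 f_M fL LM m_le f_min f_PL gamma_gt0 gamma_le.
pose g i := gradient (f_ i) x; pose G := enorm (gradient f x) ^+ 2.
have L_ge0 : 0 <= L by case: fL.
have mean_inner : mean (fun i => dot (g i) (gradient f x)) = G.
  rewrite mean_dot -gradient_average -?enorm_sqr // => i.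
  by case: (f_M i) => _.
have step_le i : f (x - gamma *: g i) - f xs <=
    (f x - f xs) + (- gamma * dot (g i) (gradient f x)
      + L * gamma ^+ 2 * M * ((f_ i x - f_ i xs) + (f_ i xs - m i))).
  have := descent_lemma x (- gamma *: g i) fL; rewrite scaleNr.
  have := gradient_sqr_le x M_gt0 (f_M i) (m_le i); rewrite -/(g i).
  rewrite dotC -scaleNr dotZl enormZ normrN gtr0_norm // exprMn.
  have : 0 <= L / 2 * gamma ^+ 2 by rewrite mulr_ge0 ?divr_ge0 ?sqr_ge0.
  move=> /ler_wpM2l /[apply].
  set e := enorm _ ^+ 2; set D := dot _ _; set y := f _; lra.
apply: le_trans (le_mean step_le) _.
rewrite meanD mean_cst // meanD !meanZ meanD -/s mean_inner.
have -> : mean (fun i => f_ i x - f_ i xs) = f x - f xs.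
  rewrite meanD; congr (_ + _).
  by under eq_fun do rewrite -mulN1r; rewrite meanZ mulN1r.
set D := f x - f xs.
have D_ge0 : 0 <= D by rewrite subr_ge0.
have s_ge0 : 0 <= s.
  by rewrite -(mean_cst 0 n_gt0) le_mean // => i; rewrite subr_ge0.
have gM : gamma * M ^+ 2 <= mu by rewrite -ler_pdivlMr ?exprn_gt0.
have PL : 2 * mu * D <= G by exact: f_PL.
have curvature_le : L * gamma ^+ 2 * M * D <= mu * gamma * D.
  rewrite ler_wpM2r // (_ : _ * M = gamma * (L * gamma * M)); last by ring.
  rewrite [mu * _]mulrC ler_pM2l // (le_trans _ gM) //.
  rewrite (_ : gamma * M ^+ 2 = M * gamma * M); last by ring.
  by rewrite !ler_pM2r.
have noise_le : L * gamma ^+ 2 * M * s <= mu * gamma * (L * s / M).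
  have -> : L * gamma ^+ 2 * M * s = gamma * (L * s / M) * (gamma * M ^+ 2).
    by field; rewrite gt_eqF.
  rewrite mulrC -[leRHS]mulrA ler_wpM2r //.
  exact: mulr_ge0 (ltW gamma_gt0) (divr_ge0 (mulr_ge0 L_ge0 s_ge0) (ltW M_gt0)).
have := ler_wpM2l (ltW gamma_gt0) PL; lra.
Qed.

(** * Expectations along a chain driven by independent uniform indices *)

Fixpoint chain (S : Type) (n : nat) (step : 'I_n -> S -> S) (x0 : S)
    (idx : nat -> 'I_n) (k : nat) : S :=
  if k is k'.+1 then step (idx k') (chain step x0 idx k') else x0.

(** The transition operator of the chain, acting on functions of the state. *)
Definition markov (R : realType) (S : Type) (n : nat) (step : 'I_n -> S -> S)
    (F : S -> R) (x : S) : R :=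
  mean (fun i => F (step i x)).

Lemma iter_markov_mean (R : realType) (S : Type) (n : nat)
    (step : 'I_n -> S -> S) (G : 'I_n -> S -> R) (k : nat) (x : S) :
  iter k (markov step) (fun y => mean (fun i => G i y)) x =
  mean (fun i => iter k (markov step) (G i) x).
Proof.
elim: k x => [//|k IHk] x; rewrite iterS /markov.
under eq_fun do rewrite IHk.
rewrite /mean -!mulr_sumr exchange_big /= mulr_sumr; congr (_ * _).
Qed.

Definition cylinder (T : Type) (n : nat) (I : nat -> T -> 'I_n) (s : {fset nat})
    (A : nat -> set 'I_n) : set T :=
  \bigcap_(j in [set` s]) (I j @^-1` A j).

Lemma bigsetU_fibers (T : Type) (n : nat) (X : T -> 'I_n) (B : set T) :
  B = \big[setU/set0]_(i < n) (B `&` X @^-1` [set i]).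
Proof.
rewrite -bigcup_seq; apply/seteqP; split=> w; last by case=> i _ [].
by move=> Bw; exists (X w); rewrite /= ?mem_index_enum.
Qed.

(** The state at time [k] is a function of finitely many discrete variables, so
    every set of states defines an event and [S] needs no sigma-algebra. *)
Lemma chain_preimage_measurable (disp : measure_display)
    (T : measurableType disp) (S : Type) (n : nat) (step : 'I_n -> S -> S)
    (x0 : S) (I : nat -> T -> 'I_n) (k : nat) (B : set S) :
  (forall j, random_index (I j)) ->
  measurable [set w | B (chain step x0 (I^~ w) k)].
Proof.
move=> mI; elim: k B => [|k IHk] B /=.
  have [Bx0|nBx0] := pselect (B x0).
    by rewrite (_ : mkset _ = setT) //; apply/seteqP; split.
  by rewrite (_ : mkset _ = set0) //; apply/seteqP; split.
rewrite [mkset _](bigsetU_fibers (I k)); apply: bigsetU_measurable => i _.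
rewrite (_ : _ `&` _ = I k @^-1` [set i] `&`
    [set w | B (step i (chain step x0 (I^~ w) k))]).
  by apply: measurableI; [exact: mI | exact: IHk [set y | B (step i y)]].
by apply/seteqP; split=> w /= []; [move=> + Iki | move=> Iki]; rewrite Iki.
Qed.

(** Independence of the state at time [k] from the indices drawn from time [k]
    on. The cylinder makes the induction work: splitting the event according to
    the value [i] of the index at time [k] turns the state at time [k.+1] into
    [step i] of the state at time [k], and moves the constraint on that index
    into the cylinder, which now constrains indices from time [k] on. *)
Lemma integral_chain_cylinder (disp : measure_display)
    (T : measurableType disp) (R : realType) (P : probability T R) (S : Type)
    (n : nat) (step : 'I_n -> S -> S) (x0 : S) (I : nat -> T -> 'I_n)
    (k : nat) (F : S -> R) (s : {fset nat}) (A : nat -> set 'I_n) :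
  (forall j, random_index (I j)) -> (forall j, uniform_index P (I j)) ->
  mutually_independent P I -> (forall j, j \in s -> (k <= j)%N) ->
  (\int[P]_(w in cylinder I s A) (F (chain step x0 (I^~ w) k))%:E =
   (iter k (markov step) F x0)%:E * P (cylinder I s A))%E.
Proof.
move=> mI uI indI.
have mC s' A' : measurable (cylinder I s' A').
  by apply: fin_bigcap_measurable => // j _; exact: mI.
elim: k F s A => [|k IHk] F s A s_ge.
  by rewrite -integral_cst.
pose A' i j := if j == k then [set i] else A j.
have k_notin : k \notin s by apply/negP => /s_ge; rewrite ltnn.
have fiberE i : cylinder I s A `&` I k @^-1` [set i] =
    cylinder I (k |` s)%fset (A' i).
  apply/seteqP; split=> w /=.
    move=> [Cw Iki] j /=; rewrite !inE /A' => /orP[/eqP ->|js].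
      by rewrite eqxx.
    by case: eqP => [->//|_]; exact: Cw.
  move=> Cw; split=> [j /= js|].
    have := Cw j; rewrite /= !inE js orbT /A' => /(_ isT).
    by case: eqP => // jk; rewrite -jk js in k_notin.
  by have := Cw k; rewrite /= !inE eqxx /A' eqxx => /(_ isT).
have probE i : P (cylinder I (k |` s)%fset (A' i)) =
    ((n%:R^-1)%:E * P (cylinder I s A))%E.
  rewrite /cylinder !indI big_fsetU1 //= /A' eqxx uI; congr (_ * _)%E.
  apply: eq_big_seq => j js; case: eqP => // jk.
  by rewrite -jk js in k_notin.
rewrite [X in integral _ X](bigsetU_fibers (I k)) integral_bigsetU_EFin;
  first last.
- rewrite -bigsetU_fibers => mD Y mY.
  apply: measurableI => //.
  exact: (chain_preimage_measurable step x0 k.+1 (fun y => Y (F y)%:E)).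
- by move=> i j _ _ [w [[_ <-] [_ <-]]].
- exact: index_enum_uniq.
- by move=> i; rewrite fiberE.
have pC : P (cylinder I s A) \is a fin_num by rewrite fin_num_measure.
have -> : (iter k.+1 (markov step) F x0 =
    mean (fun i => iter k (markov step) (F \o step i) x0)).
  by rewrite iterSr -iter_markov_mean.
rewrite -(fineK pC) -EFinM /mean mulrC mulrA mulr_sumr -sumEFin.
apply: eq_bigr => i _; rewrite fiberE.
rewrite (eq_integral (fun w => (F (step i (chain step x0 (I^~ w) k)))%:E)).
  rewrite (IHk (F \o step i)).
    by rewrite probE -(fineK pC) -!EFinM; congr (_%:E); ring.
  by move=> j; rewrite !inE => /orP[/eqP ->//|/s_ge /ltnW].
by move=> w /set_mem; rewrite -fiberE /= => -[_ ->].
Qed.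

Lemma expectation_chain (disp : measure_display)
    (T : measurableType disp) (R : realType) (P : probability T R) (S : Type)
    (n : nat) (step : 'I_n -> S -> S) (x0 : S) (I : nat -> T -> 'I_n)
    (F : S -> R) (k : nat) :
  (forall j, random_index (I j)) -> (forall j, uniform_index P (I j)) ->
  mutually_independent P I ->
  ('E_P[fun w => F (chain step x0 (I^~ w) k)] =
   (iter k (markov step) F x0)%:E)%E.
Proof.
move=> mI uI indI.
have := @integral_chain_cylinder _ _ _ P _ _ step x0 I k F fset0 (fun=> setT)
  mI uI indI.
rewrite /cylinder set_fset0 bigcap_set0 probability_setT mule1 unlock.
by apply.
Qed.

Lemma sgd_chain (R : realType) (d n : nat) (f_ : 'I_n -> 'rV[R]_d -> R)
    (gamma : R) (x0 : 'rV[R]_d) (idx : nat -> 'I_n) (k : nat) :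
  sgd f_ gamma x0 idx k =
  chain (fun i x => x - gamma *: gradient (f_ i) x) x0 idx k.
Proof. by elim: k => //= k ->. Qed.

(** [B] is the fixed point of [t |-> nu t + (1 - nu) B], and one application of
    this map multiplies the distance to [B] by [nu]. *)
Lemma iter_markov_contract (R : realType) (S : Type) (n : nat)
    (step : 'I_n -> S -> S) (F : S -> R) (nu B : R) (k : nat) (x : S) :
  (0 < n)%N -> 0 <= nu ->
  (forall y, markov step F y <= nu * F y + (1 - nu) * B) ->
  iter k (markov step) F x <= nu ^+ k * F x + (1 - nu ^+ k) * B.
Proof.
move=> n_gt0 nu_ge0 F_le; elim: k x => [|k IHk] x.
  by rewrite expr0 subrr mul0r addr0 mul1r.
rewrite iterS; apply: le_trans (le_mean (fun i => IHk (step i x))) _.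
rewrite meanD meanZ mean_cst //.
have := ler_wpM2l (exprn_ge0 k nu_ge0) (F_le x); rewrite /markov.
by set m := mean _; rewrite exprS; lra.
Qed.

(** * The convergence rate *)

(** The squared gradient is at least [2 mu (f x - fstar)] and at most
    [2 M (f x - fstar)], so [M < mu] leaves no room for [f x > fstar]. *)
Lemma pl_constant_le_smoothness (R : realType) (d : nat) (M mu fstar : R)
    (f : 'rV[R]_d -> R) :
  0 < M -> smooth M f -> (forall y, fstar <= f y) ->
  polyak_lojasiewicz mu fstar f -> mu <= M \/ forall x, f x = fstar.
Proof.
move=> M_gt0 fM f_ge f_PL; have [|M_lt_mu] := leP mu M; [by left | right=> x].
apply/eqP; rewrite -subr_eq0 eq_le subr_ge0 f_ge andbT.
have := le_trans (f_PL x) (gradient_sqr_le x M_gt0 fM f_ge).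
rewrite -subr_ge0 -mulrBl -mulrBr nmulr_rge0 //.
by rewrite nmulr_llt0 ?subr_lt0.
Qed.

Theorem corollary3p7 (R : realType) (d n : nat) (n_gt0 : (0 < n)%N)
    (f_ : 'I_n -> 'rV[R]_d -> R) (L_ : 'I_n -> R) (L mu gamma : R)
    (xs x0 : 'rV[R]_d)
    (disp : measure_display) (T : measurableType disp) (P : probability T R)
    (I : nat -> T -> 'I_n) :
  let f := average f_ in
  let Lmax := \big[Num.max/0]_(i < n) L_ i in
  let sigma2 := gradient_noise f_ xs in
  let nu := 1 - mu * gamma in
  let c := Lmax / (2 * mu) in
  (forall i, smooth (L_ i) (f_ i)) ->
  smooth L f ->
  L <= Lmax ->
  minimizer f xs ->
  (sigma2 < +oo)%E ->
  0 < mu ->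
  polyak_lojasiewicz mu (f xs) f ->
  0 < gamma -> gamma <= mu / Lmax ^+ 2 ->
  (forall k, random_index (I k)) ->
  (forall k, uniform_index P (I k)) ->
  mutually_independent P I ->
  forall k : nat,
    ('E_P[(fun w => f (sgd f_ gamma x0 (fun j => I j w) k) - f xs)%R] <=
     (nu ^+ k * (f x0 - f xs)
      + L * fine sigma2 * gamma / (2 * (1 - nu) * c))%R%:E)%E.
Proof.
move=> f Lmax sigma2 nu c f_smooth fL L_le f_min noise_lty mu_gt0 f_PL
  gamma_gt0 gamma_le I_meas I_unif I_indep k.
(* Division by zero yields zero: [Lmax = 0] would force [gamma <= 0]. *)
have Lmax_gt0 : 0 < Lmax.
  rewrite lt_def bigmax_ge_id andbT; apply: contraTneq gamma_gt0 => Lmax0.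
  by rewrite -leNgt (le_trans gamma_le) // Lmax0 expr0n invr0 mulr0.
have f_Lmax i : smooth Lmax (f_ i).
  by apply: smooth_weaken (f_smooth i); exact: le_bigmax.
have [m [m_le noiseE]] := gradient_noise_finite n_gt0 noise_lty.
set x_ := (fun w : T => _).
have -> : x_ = (fun w => f (chain (fun i x => x - gamma *: gradient (f_ i) x)
    x0 (I^~ w) k) - f xs).
  by apply/funext => w; rewrite /x_ sgd_chain.
rewrite (expectation_chain _ _ (fun x => f x - f xs)) // lee_fin.
have -> : L * fine sigma2 * gamma / (2 * (1 - nu) * c) = L * fine sigma2 / Lmax.
  by rewrite subKr /c; field; rewrite !gt_eqF.
set B := L * _ / _.
have B_ge0 : 0 <= B.
  rewrite divr_ge0 ?(ltW Lmax_gt0) // mulr_ge0 //; first by case: fL.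
  rewrite /sigma2 noiseE -(mean_cst 0 n_gt0) le_mean // => i.
  by rewrite subr_ge0.
have step_le x : markov (fun i x => x - gamma *: gradient (f_ i) x)
    (fun x => f x - f xs) x <= nu * (f x - f xs) + (1 - nu) * B.
  rewrite /B /sigma2 noiseE /nu subKr.
  exact: sgd_one_step.
(* If [mu <= Lmax] then [mu gamma <= (mu / Lmax)^2 <= 1]. *)
have [mu_le|f_cst] :=
  pl_constant_le_smoothness Lmax_gt0 (smooth_weaken L_le fL) f_min f_PL.
  have nu_ge0 : 0 <= nu.
    rewrite subr_ge0 (le_trans (ler_wpM2l (ltW mu_gt0) gamma_le)) //.
    rewrite mulrA -expr2 -expr_div_n expr_le1 //.
      by rewrite ler_pdivrMr // mul1r.
    by rewrite divr_ge0 // ltW.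
  apply: le_trans (iter_markov_contract k x0 n_gt0 nu_ge0 step_le) _.
  by rewrite lerD2l mulrBl mul1r gerBl mulr_ge0 ?exprn_ge0.
rewrite f_cst subrr mulr0 add0r.
have -> : (fun x => f x - f xs) = (fun=> 0).
  by apply/funext => x; rewrite f_cst subrr.
elim: k x0 {x_} => //= k IHk y.
by rewrite -[leRHS](mean_cst B n_gt0) le_mean // => i; exact: IHk.
Qed.
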